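(* Let $\tau>0$. Suppose that the following hold. (1) $\phi$ is smooth, $\int_{\mathcal X} e^{-\phi(x)}\,dx=1$, and for any time $\tau>0$ there is a constant $C^{\mathrm{Lions}}_\tau>0$ such that for all $g\in \mathrm L^2(\mathrm U_\tau\otimes\mu)$ $$\Big\|g-\iint_{[0,\tau]\times\mathcal X} g\,d\mathrm U_\tau\,d\mu\Big\|^2_{\mathrm L^2(\mathrm U_\tau\otimes\mu)}\le C^{\mathrm{Lions}}_\tau\,\|\nabla_{t,x}g\|^2_{\mathrm H^{-1}(\mathrm U_\tau\otimes\mu)}.$$ (2) $\psi$ is smooth, $\int_{\mathcal V}e^{-\psi(v)}\,dv=1$, $\int_{\mathcal V}|\nabla_v\psi|^4\,d\gamma+\int_{\mathcal V}|\nabla_v^2\psi|^2\,d\gamma<+\infty$, $\limsup_{R\to\infty}\int_{\mathcal V\setminus B(0,R)}|\nabla\psi|^{-2}\,d\gamma=0$, and the symmetric positive matrix $\mathscr M=\int_{\mathcal V}\nabla_v\psi\otimes\nabla_v\psi\,d\gamma$ is definite. (3) There is a constant $L_\phi\in\mathbb R_+$ such that $\|z\,\nabla_x\phi\|_{\mathrm L^2(\mu)}\le L_\phi\|z\|_{\mathrm H^1(\mu)}$ for all $z\in\mathrm H^1(\mu)$. Then, for all $h\in\mathrm H^1_{\mathrm{kin}}\cap\mathrm L^2_0(\mathrm U_\tau\otimes\Theta)$, $$\bar\lambda\,\|h\|^2_{\mathrm L^2(\mathrm U_\tau\otimes\Theta)}\le\|(\partial_t+T)h\|^2_{\mathrm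 L^2(\mathrm U_\tau\otimes\mu;\mathrm H^{-1}(\gamma))}+\|(\mathrm{Id}-\Pi)h\|^2_{\mathrm L^2(\mathrm U_\tau\otimes\Theta)},$$ with $$\bar\lambda=\frac1{1+C^{\mathrm{Lions}}_\tau K_{\mathrm{avg}}},$$ where $K_{\mathrm{avg}}$ is the averaging constant defined in the context.
   Context: $\mathcal X$ is the position space and $\mathcal V$ the velocity space, both of dimension $d$; typical choices are $\mathcal X=\mathbb R^d$ or $\mathcal X=(L\mathbb T)^d$ with $L>0$ and $\mathbb T=\mathbb R/\mathbb Z$, and $\mathcal V=\mathbb R^d$ or $\mathcal V=\mathbb T^d$. Given $\phi:\mathcal X\to\mathbb R$ and $\psi:\mathcal V\to\mathbb R$, set $\mu(dx)=e^{-\phi(x)}dx$, $\gamma(dv)=e^{-\psi(v)}dv$, $\Theta(dx\,dv)=\mu(dx)\,\gamma(dv)$ (probability measures). $\mathrm U_\tau(dt)=\tau^{-1}\mathbf 1_{[0,\tau]}(t)\,dt$. $\mathrm L^2_0(\mathrm U_\tau\otimes\Theta)$ is the subspace of $\mathrm L^2(\mathrm U_\tau\otimes\Theta)$ of functions with average $0$. $\mathrm H^1_{\mathrm{DC}}(\mathrm U_\tau\otimes\mu)=\{z\in\mathrm H^1(\mathrm U_\tau\otimes\mu): z(0,\cdot)=z(\tau,\cdot)=0\}$, and $\mathrm H^{-1}(\mathrm U_\tau\otimes\mu)$ is its dual with the dual norm (for vector-valued functions, that of the dual of $\mathrm H^1_{\mathrm{DC}}(\mathrm U_\tau\otimes\mu)^{d+1}$).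 $\mathrm H^{-1}(\gamma)$ is the dual of $\mathrm H^1(\gamma)$. $T=\nabla_v\psi\cdot\nabla_x-\nabla_x\phi\cdot\nabla_v$, $\Pi h=\int_{\mathcal V}h(\cdot,\cdot,v)\,\gamma(dv)$, and $\mathrm H^1_{\mathrm{kin}}=\{h\in\mathrm L^2(\mathrm U_\tau\otimes\mu,\mathrm H^1(\gamma)):(\partial_t+T)h\in\mathrm L^2(\mathrm U_\tau\otimes\mu,\mathrm H^{-1}(\gamma))\}$. $K_{\mathrm{avg}}\in\mathbb R_+$ is a constant (which exists under the hypotheses of the statement) such that for all $h\in\mathrm H^1_{\mathrm{kin}}$ $$\|\nabla_{t,x}\Pi h\|^2_{\mathrm H^{-1}(\mathrm U_\tau\otimes\mu)}\le K_{\mathrm{avg}}\left(\|(\mathrm{Id}-\Pi)h\|^2_{\mathrm L^2(\mathrm U_\tau\otimes\Theta)}+\|(\partial_t+T)h\|^2_{\mathrm L^2(\mathrm U_\tau\otimes\mu,\mathrm H^{-1}(\gamma))}\right).$$ *)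

(* Defs.v *)
From HB Require Import structures.
From mathcomp Require Import all_boot all_order all_algebra.
From mathcomp Require Import all_classical all_reals all_analysis.
Set Implicit Arguments. Unset Strict Implicit. Unset Printing Implicit Defensive.
Import Order.TTheory GRing.Theory Num.Theory.
Import numFieldNormedType.Exports.
Local Open Scope classical_set_scope.
Local Open Scope ring_scope.

(* Product sigma-algebra (equivalently, Borel sigma-algebra) on R^n. *)
Section measurable_rV.
Context (R : realType) (n : nat).
Let coord (i : 'I_n) (x : 'rV[R]_n) : R := x ord0 i.
Let rV_set0 : g_sigma_preimage coord set0.
Proof. exact: sigma_algebra0. Qed.
Let rV_setC A : g_sigma_preimage coord A -> g_sigma_preimage coord (~` A).
Proof. exact: sigma_algebraC. Qed.
Let rV_bigcup (F : _^nat) : (forall i, g_sigma_preimage coord (F i)) ->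
  g_sigma_preimage coord (\bigcup_i (F i)).
Proof. exact: sigma_algebra_bigcup. Qed.
HB.instance Definition _ := @isMeasurable.Build default_measure_display
  'rV[R]_n (g_sigma_preimage coord) rV_set0 rV_setC rV_bigcup.
End measurable_rV.


Section lebesgue_rV.
Context (R : realType).

Lemma measurable_coord n (i : 'I_n) :
  measurable_fun setT (fun x : 'rV[R]_n => x ord0 i : measurableTypeR R).
Proof.
move=> _ Y mY; rewrite setTI; apply: sub_sigma_algebra => /=.
rewrite -bigcup_seq/=; exists i => /=; first by rewrite mem_index_enum.
by exists Y => //; rewrite setTI.
Qed.

Lemma measurable_rV d (T : measurableType d) n (f : T -> 'rV[R]_n) :
  (forall i, measurable_fun setT (fun t => f t ord0 i : measurableTypeR R)) ->
  measurable_fun setT f.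
Proof.
move=> mf; apply: (@measurability _ _ _ _ _ _
  (\big[setU/set0]_(i < n) preimage_set_system setT
     (fun x : 'rV[R]_n => x ord0 i) (@measurable _ R))) => //.
move=> _ [B + <-]; rewrite -bigcup_seq/= => -[i _ [C mC <-]].
by rewrite !setTI; have := mf i measurableT C mC; rewrite setTI.
Qed.

Definition rV_cons n (p : measurableTypeR R * 'rV[R]_n) : 'rV[R]_n.+1 :=
  row_mx (const_mx p.1 : 'rV[R]_1) p.2.

Definition rV_uncons n (x : 'rV[R]_n.+1) : measurableTypeR R * 'rV[R]_n :=
  (x ord0 ord0, \row_j x ord0 (lift ord0 j)).

Lemma rV_consK n : cancel (@rV_cons n) (@rV_uncons n).
Proof.
move=> [a x]; rewrite /rV_uncons /rV_cons/=; congr pair.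
  rewrite (_ : (ord0 : 'I_n.+1) = lshift n (ord0 : 'I_1)); last exact/val_inj.
  exact: etrans (row_mxEl _ _ _ _) (mxE _ _ _ _).
apply/rowP => j; rewrite mxE (_ : lift ord0 j = rshift 1 j); last exact/val_inj.
exact: (row_mxEr (const_mx a : 'rV[R]_1)).
Qed.

Lemma measurable_rV_cons n : measurable_fun setT (@rV_cons n).
Proof.
apply: measurable_rV => i; rewrite /rV_cons.
case: (splitP (i : 'I_(1 + n))) => j ij.
  rewrite (_ : i = lshift n j); last exact/val_inj.
  rewrite (_ : (fun _ => _) = fst)//.
  by apply/funext => t; exact: etrans (row_mxEl _ _ _ _) (mxE _ _ _ _).
rewrite (_ : i = rshift 1 j); last exact/val_inj.
rewrite (_ : (fun _ => _) = (fun x : 'rV[R]_n => x ord0 j : measurableTypeR R) \o snd).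
  exact: (measurableT_comp (measurable_coord j)).
by apply/funext => t; exact: (row_mxEr (const_mx t.1 : 'rV[R]_1)).
Qed.

Lemma measurable_rV_uncons n : measurable_fun setT (@rV_uncons n).
Proof.
apply: (@measurable_fun_pair _ _ _ _ (measurableTypeR R) _ (fun x : 'rV[R]_n.+1 => x ord0 ord0) (fun x => \row_j x ord0 (lift ord0 j))); first exact: measurable_coord.
apply: measurable_rV => i.
rewrite (_ : (fun _ => _) =
  (fun x : 'rV[R]_n.+1 => x ord0 (lift ord0 i) : measurableTypeR R)).
  exact: measurable_coord.
by apply/funext => x; rewrite mxE.
Qed.

Section cons_measure.
Context n (m : {sigma_finite_measure set 'rV[R]_n -> \bar R}).

Definition cons_measure : set 'rV[R]_n.+1 -> \bar R :=
  pushforward (lebesgue_measure \x m)%E (@rV_cons n).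

Let cons_measure0 : cons_measure set0 = 0%E.
Proof. by rewrite /cons_measure /pushforward preimage_set0 measure0. Qed.

Let cons_measure_ge0 A : (0 <= cons_measure A)%E.
Proof. by rewrite /cons_measure /pushforward; exact: measure_ge0. Qed.

Let cons_measure_sigma_additive : semi_sigma_additive cons_measure.
Proof.
move=> F mF tF mUF; rewrite /cons_measure /pushforward preimage_bigcup.
have mc A : measurable A -> measurable (@rV_cons n @^-1` A).
  by move=> mA; rewrite -[X in measurable X]setTI; exact: measurable_rV_cons.
apply: measure_semi_sigma_additive.
- by move=> i; exact: mc.
- apply/trivIsetP => /= i j _ _ ij; rewrite -preimage_setI.
  by move/trivIsetP : tF => /(_ _ _ _ _ ij) ->//; rewrite preimage_set0.
- by rewrite -preimage_bigcup; exact: mc.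
Qed.

HB.instance Definition _ := isMeasure.Build _ _ _ cons_measure
  cons_measure0 cons_measure_ge0 cons_measure_sigma_additive.

Let cons_measure_sigma_finite : sigma_finite setT cons_measure.
Proof.
have /sigma_finiteP[F [FT ndF mF]] := sigma_finiteT (@lebesgue_measure R).
have /sigma_finiteP[G [GT ndG mG]] := sigma_finiteT m.
exists (fun i => @rV_uncons n @^-1` (F i `*` G i)).
  apply/seteqP; split => // x _.
  have [i _ Fi] : (\bigcup_i F i) (rV_uncons x).1 by rewrite -FT.
  have [j _ Gj] : (\bigcup_j G j) (rV_uncons x).2 by rewrite -GT.
  exists (maxn i j) => //; split.
    by move: Fi; exact/subsetPset/ndF/leq_maxl.
  by move: Gj; exact/subsetPset/ndG/leq_maxr.
move=> i; have [mFi Foo] := mF i; have [mGi Goo] := mG i.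
have mFG : measurable (F i `*` G i) by exact: measurableX.
split.
  by rewrite -[X in measurable X]setTI; exact: measurable_rV_uncons.
rewrite /cons_measure /pushforward -comp_preimage.
rewrite (_ : _ \o _ = id); last by apply/funext => x /=; rewrite rV_consK.
rewrite preimage_id [ltLHS](product_measure1E _ m mFi mGi).
by rewrite lte_mul_pinfty// ge0_fin_numE.
Qed.

HB.instance Definition _ := @Measure_isSigmaFinite.Build _ _ _
  cons_measure cons_measure_sigma_finite.

End cons_measure.

Fixpoint lebesgue_rV n : {sigma_finite_measure set 'rV[R]_n -> \bar R} :=
  if n is n'.+1 then cons_measure (lebesgue_rV n') else dirac (0 : 'rV[R]_0).

End lebesgue_rV.

Section smooth_functions.
Context (R : realType).

(* C^oo: every iterated directional derivative is differentiable everywhere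
   (the spaces [E] used below are finite-dimensional). *)
Definition smooth (E : normedModType R) (f : E -> R) : Prop :=
  forall vs : seq E, forall x,
    differentiable (foldr (fun v (g : E -> R) => 'D_v g) f vs : E -> R) x.

Definition unit_vec d (i : 'I_d) : 'rV[R]_d := delta_mx ord0 i.

End smooth_functions.

(* A d-dimensional space is a product of lines and circles: coordinate [i] runs
   over the real line if [sp i = None], and over R/LZ if [sp i = Some L].
   Functions on it are functions on R^d; those that are differentiated are
   required to be periodic in the circle coordinates, those that are only
   integrated are integrated over a fundamental domain, [cell sp]. *)
Section spaces.
Context (R : realType) (d : nat).
Implicit Types (sp : 'I_d -> option {posnum R}) (x : 'rV[R]_d).

Definition cell sp : set 'rV[R]_d :=
  [set x : 'rV[R]_d | forall i L, sp i = Some L -> 0 <= x ord0 i < L%:num].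

Definition periodic sp (f : 'rV[R]_d -> R) : Prop :=
  forall i L, sp i = Some L -> forall x, f (x + L%:num *: unit_vec R i) = f x.

Definition smooth_on sp (f : 'rV[R]_d -> R) : Prop := smooth f /\ periodic sp f.

Definition line_bounded sp (M : R) x : Prop :=
  forall i, sp i = None -> `|x ord0 i| <= M.

(* m(dx) = exp(- phi(x)) dx *)
Definition gibbs sp (phi : 'rV[R]_d -> R) (m : set 'rV[R]_d -> \bar R) : Prop :=
  forall A, measurable A ->
    m A = (\int[lebesgue_rV R d]_(x in A `&` cell sp) (expR (- phi x))%:E)%E.

Definition partial i (f : 'rV[R]_d -> R) : 'rV[R]_d -> R := 'D_(unit_vec R i) f.

Definition grad_sq (f : 'rV[R]_d -> R) x : R := \sum_i partial i f x ^+ 2.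

Definition hess_sq (f : 'rV[R]_d -> R) x : R :=
  \sum_i \sum_j partial i (partial j f) x ^+ 2.

Definition euclidean_norm x : R := Num.sqrt (\sum_i x ord0 i ^+ 2).

End spaces.

Section L2_H1.
Context (R : realType).

Section L2.
Context d (T : measurableType d) (m : {measure set T -> \bar R}).

Definition L2 : set (T -> R) := [set f | f \in Lfun m 2%:E].

Definition L2norm (f : T -> R) : \bar R := 'N[m]_2%:E[EFin \o f]%E.

End L2.

(* The data needed to define weak derivatives on an open domain: a reference
   measure, the domain, the space of smooth compactly supported test functions
   on it, and the classical partial derivatives of these. *)
Record domain d (E : measurableType d) (I : finType) := Domain {
  volume : {measure set E -> \bar R};
  region : set E;
  test_fun : set (E -> R);
  test_partial : I -> (E -> R) -> E -> R }.

Context d (E : measurableType d) (I : finType) (D : domain E I)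
  (m : {measure set E -> \bar R}).

Definition weak_partial (i : I) (f g : E -> R) : Prop :=
  forall xi, test_fun D xi ->
    \int[volume D]_(p in region D) (f p * test_partial D i xi p) =
    - \int[volume D]_(p in region D) (g p * xi p).

(* The weak derivative of [f] (unique up to a.e. equality), if it exists in
   L^2(m). *)
Definition weak_D (i : I) (f : E -> R) : E -> R :=
  xget (fun=> 0) [set g | L2 m g /\ weak_partial i f g].

Definition H1 : set (E -> R) :=
  [set f | L2 m f /\ forall i, exists2 g, L2 m g & weak_partial i f g].

Definition H1norm_sq (f : E -> R) : \bar R :=
  (L2norm m f ^+ 2 + \sum_(i : I) L2norm m (weak_D i f) ^+ 2)%E.

Definition H1norm (f : E -> R) : \bar R := (H1norm_sq f `^ 2^-1)%E.

End L2_H1.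
Arguments domain R {d} E I.

Definition dual_norm (R : realType) (Z : Type) (V : set Z) (N : Z -> \bar R)
    (l : Z -> R) : \bar R :=
  ereal_sup [set `|l z|%:E | z in [set z | V z /\ (N z <= 1)%E]].

Section position_velocity.
Context (R : realType) (d : nat) (sp : 'I_d -> option {posnum R}).

Definition domain_of : domain R 'rV[R]_d 'I_d := {|
  volume := lebesgue_rV R d;
  region := cell sp;
  test_fun := [set xi | smooth_on sp xi /\
    exists M, forall x, xi x != 0 -> line_bounded sp M x];
  test_partial := @partial R d |}.

(* The dual of H^1(m), as a set of functionals on representatives; a linear
   functional which is bounded on H^1(m) does not depend on them. *)
Definition Hm1 (m : {measure set 'rV[R]_d -> \bar R}) :
    set (('rV[R]_d -> R) -> R) :=
  [set l | (forall a f g, H1 domain_of m f -> H1 domain_of m g ->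
              l (fun v => a * f v + g v) = a * l f + l g) /\
           (dual_norm (H1 domain_of m) (H1norm domain_of m) l < +oo)%E].

Definition Hm1norm (m : {measure set 'rV[R]_d -> \bar R}) :
    (('rV[R]_d -> R) -> R) -> \bar R :=
  dual_norm (H1 domain_of m) (H1norm domain_of m).

End position_velocity.

(* [measurableTypeR R] is [R] with its Borel sigma-algebra. *)
Section time_position.
Context (R : realType) (d : nat) (sp : 'I_d -> option {posnum R})
  (tau : R) (tau_gt0 : 0 < tau).
Local Notation TX := (measurableTypeR R * 'rV[R]_d)%type.

(* The coordinates of (t, x): [None] is t, [Some i] is x_i. *)
Definition tx_dir (i : option 'I_d) : R * 'rV[R]_d :=
  if i is Some j then (0, unit_vec R j) else (1, 0).

Definition cylinder : domain R TX (option 'I_d) := {|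
  volume := (lebesgue_measure \x lebesgue_rV R d)%E;
  region := [set p | 0 < p.1 < tau /\ cell sp p.2];
  test_fun := [set xi : R * 'rV[R]_d -> R | [/\ smooth xi,
    forall t, periodic sp (fun x => xi (t, x)) &
    exists a b M, [/\ 0 < a, b < tau & forall t x, xi (t, x) != 0 ->
      a <= t <= b /\ line_bounded sp M x]]];
  test_partial := fun i (xi : R * 'rV[R]_d -> R) => 'D_(tx_dir i) xi |}.

Context (mu : probability 'rV[R]_d R).
Local Notation Umu := (uniform_prob tau_gt0 \x mu)%E.

(* [a] is the trace at time 0 (resp. tau) of [z] in H^1(U_tau (x) mu), i.e.
   the value at that time of its representative which is absolutely continuous
   in t. *)
Definition trace_initial (z : TX -> R) (a : 'rV[R]_d -> R) : Prop :=
  {ae Umu, forall p, z p = a p.2 +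
    \int[lebesgue_measure]_(s in `[0, p.1]) weak_D cylinder Umu None z (s, p.2)}.

Definition trace_final (z : TX -> R) (a : 'rV[R]_d -> R) : Prop :=
  {ae Umu, forall p, z p = a p.2 -
    \int[lebesgue_measure]_(s in `[p.1, tau]) weak_D cylinder Umu None z (s, p.2)}.

Definition H1DC : set (TX -> R) :=
  [set z | [/\ H1 cylinder Umu z, trace_initial z (fun=> 0) &
               trace_final z (fun=> 0)]].

(* The distribution grad_{t,x} g acting on Z = (Z_t, Z_x1, ..., Z_xd), with
   L^2(U_tau (x) mu) as pivot space: the adjoints of d/dt and d/dx_i are
   - d/dt and - d/dx_i + d_i phi. *)
Definition grad_pairing (phi : 'rV[R]_d -> R) (g : TX -> R)
    (Z : option 'I_d -> TX -> R) : R :=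
  \int[Umu]_p (g p *
    (- weak_D cylinder Umu None (Z None) p +
     \sum_i (Z (Some i) p * partial i phi p.2 -
             weak_D cylinder Umu (Some i) (Z (Some i)) p))).

(* || grad_{t,x} g || in H^{-1}(U_tau (x) mu), the dual of H^1_DC ^ (d + 1). *)
Definition grad_Hm1norm (phi : 'rV[R]_d -> R) (g : TX -> R) : \bar R :=
  dual_norm [set Z : option 'I_d -> TX -> R | forall i, H1DC (Z i)]
    (fun Z => ((\sum_i H1norm_sq cylinder Umu (Z i)) `^ 2^-1)%E)
    (grad_pairing phi g).

End time_position.

Section kinetic.
Context (R : realType) (d : nat) (spX spV : 'I_d -> option {posnum R})
  (phi psi : 'rV[R]_d -> R) (tau : R) (tau_gt0 : 0 < tau)
  (mu gamma : probability 'rV[R]_d R).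
Local Notation TX := (measurableTypeR R * 'rV[R]_d)%type.
Local Notation TXV := (measurableTypeR R * 'rV[R]_d * 'rV[R]_d)%type.
Local Notation Umu := (uniform_prob tau_gt0 \x mu)%E.
Local Notation UTheta := (uniform_prob tau_gt0 \x mu \x gamma)%E.

Definition velocity_average (h : TXV -> R) (p : TX) : R :=
  \int[gamma]_v h (p, v).

Definition fluctuation (h : TXV -> R) (q : TXV) : R :=
  h q - velocity_average h q.1.

(* Smooth compactly supported functions on (0, tau) x X x V. *)
Definition phase_test (zeta : R * 'rV[R]_d * 'rV[R]_d -> R) : Prop :=
  [/\ smooth zeta,
      forall t v, periodic spX (fun x => zeta (t, x, v)),
      forall t x, periodic spV (fun v => zeta (t, x, v)) &
      exists a b M, [/\ 0 < a, b < tau & forall t x v, zeta (t, x, v) != 0 ->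
        [/\ a <= t <= b, line_bounded spX M x & line_bounded spV M v]]].

(* (d_t + T) zeta *)
Definition transport (zeta : R * 'rV[R]_d * 'rV[R]_d -> R)
    (q : R * 'rV[R]_d * 'rV[R]_d) : R :=
  'D_((1, 0, 0) : R * 'rV[R]_d * 'rV[R]_d) zeta q +
  \sum_i (partial i psi q.2 *
            'D_((0, unit_vec R i, 0) : R * 'rV[R]_d * 'rV[R]_d) zeta q -
          partial i phi q.1.2 *
            'D_((0, 0, unit_vec R i) : R * 'rV[R]_d * 'rV[R]_d) zeta q).

Definition L2_H1 : set (TXV -> R) :=
  [set h | [/\ L2 UTheta h,
    {ae Umu, forall p, H1 (domain_of spV) gamma (fun v => h (p, v))} &
    (\int[Umu]_p H1norm_sq (domain_of spV) gamma (fun v => h (p, v)) < +oo)%E]].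

(* L^2(U_tau (x) mu, H^{-1}(gamma)); H^{-1}(gamma) being separable, weak
   measurability is strong measurability. *)
Definition L2_Hm1norm_sq (F : TX -> ('rV[R]_d -> R) -> R) : \bar R :=
  (\int[Umu]_p Hm1norm spV gamma (F p) ^+ 2)%E.

Definition L2_Hm1 : set (TX -> ('rV[R]_d -> R) -> R) :=
  [set F | [/\ forall p, Hm1 spV gamma (F p),
    forall z, H1 (domain_of spV) gamma z -> measurable_fun setT (F^~ z) &
    (L2_Hm1norm_sq F < +oo)%E]].

(* (d_t + T) h = F as distributions, with L^2(U_tau (x) Theta) as pivot space,
   in which d_t + T is antisymmetric on test functions. *)
Definition weak_transport (h : TXV -> R) (F : TX -> ('rV[R]_d -> R) -> R) :
    Prop :=
  forall zeta, phase_test zeta ->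
    \int[Umu]_p F p (fun v => zeta (p, v)) =
    - \int[UTheta]_q (h q * transport zeta q).

Definition Hkin : set (TXV -> R) :=
  [set h | L2_H1 h /\ exists2 F, L2_Hm1 F & weak_transport h F].

(* The squared norm of (d_t + T) h in L^2(U_tau (x) mu, H^{-1}(gamma)), for [h]
   in [Hkin]; the representative [F] is unique up to a.e. equality. *)
Definition transport_norm_sq (h : TXV -> R) : \bar R :=
  L2_Hm1norm_sq
    (xget (fun _ _ => 0) [set F | L2_Hm1 F /\ weak_transport h F]).

End kinetic.

(* Main.v *)
Require Import Defs.
From HB Require Import structures.
From mathcomp Require Import all_boot all_order all_algebra.
From mathcomp Require Import all_classical all_reals all_analysis measurable_realfun.
Import Order.TTheory GRing.Theory Num.Theory.
Import numFieldNormedType.Exports.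
Local Open Scope classical_set_scope.
Local Open Scope ring_scope.

(* Since Pi is the average over v, Pythagoras in L^2(gamma), integrated over
   (t, x), gives ||h||^2 = ||Pi h||^2 + ||(Id - Pi) h||^2.  If h has mean 0 then
   so does Pi h, and the Lions inequality followed by the averaging inequality
   bounds ||Pi h||^2 by C_Lions K_avg times the right-hand side. *)

Lemma poweR_sqr {R : realType} (x : \bar R) : (0 <= x -> x `^ 2 = x ^+ 2)%E.
Proof.
case: x => [r r0|_|//]; last by rewrite poweRyr.
by rewrite poweR_EFin powR_mulrn// EFin_expe.
Qed.

Lemma L2norm_sqr {R : realType} {d} {T : measurableType d}
    {m : {measure set T -> \bar R}} {f : T -> R} :
  (L2norm m f ^+ 2 = \int[m]_x (f x ^+ 2)%:E)%E.
Proof.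
rewrite /L2norm -poweR_sqr ?Lnorm_ge0// poweR_Lnorm//.
by apply: eq_integral => x _ /=; rewrite powR_mulrn// real_normK// num_real.
Qed.

Lemma measurable_L2 {R : realType} {d} {T : measurableType d}
    {m : {measure set T -> \bar R}} {f : T -> R} :
  L2 m f -> measurable_fun setT f.
Proof. by rewrite /L2/= inE => /andP[]; rewrite inE. Qed.

Lemma L2P {R : realType} {d} {T : measurableType d}
    {m : {measure set T -> \bar R}} {f : T -> R} :
  L2 m f <-> measurable_fun setT f /\ (L2norm m f ^+ 2 < +oo)%E.
Proof.
split=> [Lf|[mf foo]].
  split; first exact: measurable_L2 Lf.
  have /integrableP[_] := Lfun2_integrable_sqr Lf; apply: le_lt_trans.
  rewrite L2norm_sqr le_eqVlt; apply/orP; left; apply/eqP/eq_integral => x _ /=.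
  by rewrite ger0_norm// sqr_ge0.
rewrite /L2/= inE; apply/andP; split; rewrite inE//= /finite_norm.
by apply: (@lty_poweRy _ _ 2) => //; rewrite poweR_sqr// Lnorm_ge0.
Qed.

(** The variance formula Var f = E[f^2] - (E f)^2, with the squared mean moved to the other side. *)
Lemma integral_sqr_variance {R : realType} {d} {T : measurableType d}
    {Q : probability T R} {f : T -> R} : L2 Q f ->
  (\int[Q]_v (f v ^+ 2)%:E =
   \int[Q]_v ((f v - (\int[Q]_w f w)%R) ^+ 2)%:E +
   ((\int[Q]_w f w)%R ^+ 2)%:E)%E.
Proof.
move=> Lf; have := varianceE Lf.
(* Square integrability under a probability makes the mean finite, so it coincides with the
   real-valued integral and its square cancels in the extended reals. *)
have If : 'E_Q[f]%E \is a fin_num.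
  by rewrite expectation_fin_num// Lfun_subset12// fin_num_measure.
rewrite -[in X in _ = X](fineK If) /variance covariance.unlock.
rewrite expectation.unlock => /(congr1 (fun x => x + ((\int[Q]_w f w)%R ^+ 2)%:E)%E).
by rewrite -EFin_expe subeK.
Qed.

Section average.
Context {R : realType} {d1 d2} {T1 : measurableType d1} {T2 : measurableType d2}
  {P : probability T1 R} {Q : probability T2 R} {h : T1 * T2 -> R}.
Hypothesis Lh : L2 (P \x Q)%E h.
Let avg (p : T1) : R := \int[Q]_v h (p, v).

Let mh : measurable_fun setT h := measurable_L2 Lh.

Let Ih : (P \x Q)%E.-integrable setT (EFin \o h).
Proof.
apply/Lfun1_integrable/Lfun_subset12 => //.
exact: (fin_num_measure ((P \x Q)%E : probability (T1 * T2)%type R)).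
Qed.

Let mavg : measurable_fun setT avg.
Proof.
rewrite (_ : avg = fine \o fubini_F Q (EFin \o h))//.
apply: (measurableT_comp (fine_measurable measurableT)).
exact: measurable_fubini_F Ih.
Qed.

(** Fubini. [avg] is the [fine] of the inner extended integral; the two agree wherever the latter is
    finite, hence [P]-almost everywhere. *)
Lemma integral_average : \int[P]_p avg p = \int[(P \x Q)%E]_q h q.
Proof.
congr fine; rewrite -(integral12_prod_meas1 Ih).
have IF := integrable_fubini_F Ih.
apply: ae_eq_integral => //; [exact/measurable_EFinP|exact: measurable_int IF|].
have := integrable_ae measurableT IF; apply: filterS => p Fp _ /=.
by rewrite fineK//; exact: Fp.
Qed.

(** Fubini for h^2, which is integrable on the product. *)
Lemma ae_L2_section : {ae P, forall p, L2 Q (fun v => h (p, v))}.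
Proof.
have := ae_integrable1 (Lfun2_integrable_sqr Lh); apply: filterS => p Ip.
apply/L2P; split; first exact: measurableT_comp.
rewrite L2norm_sqr; have /integrableP[_] := Ip; apply: le_lt_trans.
rewrite le_eqVlt; apply/orP; left; apply/eqP/eq_integral => v _ /=.
by rewrite ger0_norm// sqr_ge0.
Qed.

(** Pythagoras for the projection onto functions of p. Every term is nonnegative, so Tonelli gives
    the identity in the extended reals before [avg] is known to be square integrable. *)
Lemma L2norm_sqr_average :
  (L2norm (P \x Q) h ^+ 2 =
   L2norm (P \x Q) (fun q => h q - avg q.1)%R ^+ 2 + L2norm P avg ^+ 2)%E.
Proof.
have mf : measurable_fun setT (fun q : T1 * T2 => h q - avg q.1).
  by apply: measurable_funB => //; exact: measurableT_comp.
have msqr d (T : measurableType d) (f : T -> R) : measurable_fun setT f ->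
    measurable_fun setT (fun x => (f x ^+ 2)%:E).
  by move=> ?; apply/measurable_EFinP; exact: measurable_funX.
rewrite !L2norm_sqr !fubini_tonelli1//; try exact: msqr; last 2 first.
- by move=> q; rewrite lee_fin sqr_ge0.
- by move=> q; rewrite lee_fin sqr_ge0.
have mF (f : T1 * T2 -> R) : measurable_fun setT f ->
    measurable_fun setT (fubini_F Q (fun q => (f q ^+ 2)%:E)).
  move=> ?; apply: measurable_fun_fubini_tonelli_F; first exact: msqr.
  by move=> q; rewrite lee_fin sqr_ge0.
have F0 (f : T1 * T2 -> R) p : (0 <= fubini_F Q (fun q => (f q ^+ 2)%:E) p)%E.
  by apply: integral_ge0 => v _; rewrite lee_fin sqr_ge0.
(* Merging the right-hand side into one integral over [P] leaves the variance identity on each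
   fibre, which is available only for almost every p. *)
rewrite -ge0_integralD//; [|exact: mF|by move=> *; rewrite lee_fin sqr_ge0|exact: msqr].
apply: ge0_ae_eq_integral => //; [exact: mF| | |].
- by apply: emeasurable_funD; [exact: mF|exact: msqr].
- by move=> p _; rewrite adde_ge0// lee_fin sqr_ge0.
- by apply: filterS ae_L2_section => p Lp _; exact: integral_sqr_variance Lp.
Qed.

Lemma L2_average : L2 P avg.
Proof.
apply/L2P; split=> //.
have [_] := L2P.1 Lh; apply: le_lt_trans.
by rewrite L2norm_sqr_average leeDr// sqre_ge0.
Qed.

End average.

Theorem proposition15 (R : realType) (d : nat)
  (spX spV : 'I_d -> option {posnum R})
  (phi psi : 'rV[R]_d -> R)
  (mu gamma : probability 'rV[R]_d R)
  (mu_gibbs : gibbs spX phi mu)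
  (gamma_gibbs : gibbs spV psi gamma)
  (tau : R) (tau_gt0 : 0 < tau)
  (* (1) *)
  (phi_smooth : smooth_on spX phi)
  (phi_norm : (\int[lebesgue_rV R d]_(x in cell spX) (expR (- phi x))%:E = 1)%E)
  (C_Lions : R -> R)
  (C_Lions_gt0 : forall s, 0 < s -> 0 < C_Lions s)
  (Lions : forall (s : R) (s_gt0 : 0 < s)
      (g : measurableTypeR R * 'rV[R]_d -> R),
    L2 (uniform_prob s_gt0 \x mu)%E g ->
    (L2norm (uniform_prob s_gt0 \x mu)
       (fun p => g p - \int[(uniform_prob s_gt0 \x mu)%E]_q g q)%R ^+ 2
     <= (C_Lions s)%:E * grad_Hm1norm spX s_gt0 mu phi g ^+ 2)%E)
  (* (2) *)
  (psi_smooth : smooth_on spV psi)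
  (psi_norm : (\int[lebesgue_rV R d]_(v in cell spV) (expR (- psi v))%:E = 1)%E)
  (psi_moments : (\int[gamma]_v (grad_sq psi v ^+ 2)%:E +
                  \int[gamma]_v (hess_sq psi v)%:E < +oo)%E)
  (psi_tail : limf_esup (fun r : R =>
     \int[gamma]_(v in [set v | r <= euclidean_norm v]%R)
       ((grad_sq psi v)%:E)^-1)%E +oo%R = 0%E)
  (psi_definite : forall u : 'rV[R]_d, u != 0 ->
     0 < (u *m (\matrix_(i, j) \int[gamma]_v (partial i psi v * partial j psi v))
            *m u^T) ord0 ord0)
  (* (3) *)
  (L_phi : R) (L_phi_ge0 : 0 <= L_phi)
  (phi_lipschitz : forall z, H1 (domain_of spX) mu z ->
    (L2norm mu (fun x => `|z x| * Num.sqrt (grad_sq phi x))%R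
     <= L_phi%:E * H1norm (domain_of spX) mu z)%E)
  (* the averaging constant *)
  (K_avg : R) (K_avg_ge0 : 0 <= K_avg)
  (averaging : forall h, Hkin spX spV phi psi tau_gt0 mu gamma h ->
    (grad_Hm1norm spX tau_gt0 mu phi (velocity_average gamma h) ^+ 2
     <= K_avg%:E *
        (L2norm (uniform_prob tau_gt0 \x mu \x gamma)%E (fluctuation gamma h) ^+ 2
         + transport_norm_sq spX spV phi psi tau_gt0 mu gamma h))%E) :
  forall h, Hkin spX spV phi psi tau_gt0 mu gamma h ->
    \int[(uniform_prob tau_gt0 \x mu \x gamma)%E]_q h q = 0 ->
    ((1 + C_Lions tau * K_avg)^-1%:E *
       L2norm (uniform_prob tau_gt0 \x mu \x gamma)%E h ^+ 2
     <= transport_norm_sq spX spV phi psi tau_gt0 mu gamma h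
        + L2norm (uniform_prob tau_gt0 \x mu \x gamma)%E (fluctuation gamma h) ^+ 2)%E.
Proof.
move=> h kin_h mean_h; have Lh := kin_h.1; case: Lh => Lh _ _.
set A := (L2norm _ (fluctuation gamma h) ^+ 2)%E.
set B := transport_norm_sq _ _ _ _ _ _ _ _.
have A0 : (0 <= A)%E by exact: sqre_ge0.
have B0 : (0 <= B)%E by apply: integral_ge0 => p _; exact: sqre_ge0.
have C0 : 0 <= C_Lions tau by exact/ltW/C_Lions_gt0.
have CK0 : 0 <= C_Lions tau * K_avg by exact: mulr_ge0.
have avg_le : (L2norm (uniform_prob tau_gt0 \x mu) (velocity_average gamma h) ^+ 2
    <= (C_Lions tau * K_avg)%:E * (A + B))%E.
  have := Lions _ tau_gt0 _ (L2_average Lh).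
  (* Pi h has the same mean as h, namely 0, so the centring in the Lions inequality disappears. *)
  rewrite integral_average// mean_h; under eq_fun do rewrite subr0.
  move=> /le_trans; apply; rewrite EFinM -muleA.
  by apply: lee_wpmul2l; [rewrite lee_fin|exact: averaging].
(* The inverse constant moves to the right as the factor 1 + [C_Lions tau * K_avg]. Its two summands
   are spent separately: the 1 pays for the fluctuation, since [A] is at most [A + B], and the
   product pays for Pi h through [avg_le]. *)
rewrite lee_pdivrMl; last by rewrite ltr_wpDr.
rewrite EFinD ge0_muleDl ?lee_fin// mul1e [(B + A)%E]addeC.
rewrite L2norm_sqr_average//; apply: leeD avg_le.
by rewrite leeDl.
Qed.
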